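(* Let $F=\{A_F;f_1,\dots,f_N\}$ and $G=\{A_G;g_1,\dots,g_N\}$ be IFSs with the same number $N$ of functions, with non-overlapping attractors $A_F$ and $A_G$, and let $\mu_F$ and $\mu_G$ be the invariant measures of $F$ and $G$ associated with the same probability vector. Let $T_{FG}:A_F\to A_G$ and $T_{GF}:A_G\to A_F$ be the fractal transformations, let $L_F^2=L^2(A_F,\mu_F)$ and $L_G^2=L^2(A_G,\mu_G)$ be the spaces of complex-valued square integrable functions (identified when equal almost everywhere), and define $$(U_{FG}\varphi_F)(y)=\varphi_F(T_{GF}(y)),\qquad (U_{GF}\varphi_G)(x)=\varphi_G(T_{FG}(x))$$ for $\varphi_F\in L_F^2$, $\varphi_G\in L_G^2$, $x\in A_F$, $y\in A_G$. Then (1) $U_{FG}:L_F^2\to L_G^2$ and $U_{GF}:L_G^2\to L_F^2$ are (linear) isometries; (2) $U_{GF}\circ U_{FG}=\mathrm{id}$ on $L_F^2$ and $U_{FG}\circ U_{GF}=\mathrm{id}$ on $L_G^2$; (3) $\langle\psi_G,U_{FG}\varphi_F\rangle_G=\langle U_{GF}\psi_G,\varphi_F\rangle_F$ for all $\psi_G\in L_G^2$ and $\varphi_F\in L_F^2$.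
   Context: IFS: An IFS $F=\{A;f_1,\dots,f_N\}$ with attractor $A$ consists of a nonempty compact metric space $A$ and maps $f_i:A\to A$, $i\in I=\{1,\dots,N\}$, each of which is a homeomorphism onto its image, which are contractions (there is $\lambda\in[0,1)$ with $d(f_i(x),f_i(y))\le\lambda d(x,y)$ for all $x,y\in A$ and all $i\in I$), and such that $A=\bigcup_{i=1}^N f_i(A)$. For $U\subset A$ put $F^{-1}(U)=\bigcup_{i=1}^N f_i^{-1}(U)$, where $f_i^{-1}(U)=\{x\in A: f_i(x)\in U\}$, and let $F^{-k}$ be the $k$-fold composition of $F^{-1}$. The critical set is $C=\bigcup_{i\ne j} f_i(A)\cap f_j(A)$. The dynamical boundary is $\partial A=\overline{\bigcup_{k=1}^\infty F^{-k}(C)}$ (closure in $A$). $A$ is non-overlapping (w.r.t. $F$) when $A\neq\partial A$. Code space: $I^\infty$ is the set of infinite sequences $\theta=\theta_1\theta_2\cdots$ over $I$, with metric $d(\theta,\sigma)=2^{-k}$ where $k$ is the least index with $\theta_k\neq\sigma_k$. The coding map $\pi_F:I^\infty\to A$ is $\pi_F(\sigma)=\lim_{k\to\infty}f_{\sigma_1}\circ\cdots\circ f_{\sigma_k}(a)$, independent of $a\in A$; it is continuous and onto. $I^\infty$ is ordered lexicographically, with the convention $1>2>\cdots>N$: $\theta>\sigma$ iff $\theta\ne\sigma$ and $\theta_k>\sigma_k$ in this order of symbols at the least index $k$ where they differ. The top section $\tau_F:A\to I^\infty$ is $\tau_F(x)=\max\pi_F^{-1}(x)$ (lexicographic maximum).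 Fractal transformations: $T_{FG}=\pi_G\circ\tau_F$ and $T_{GF}=\pi_F\circ\tau_G$. Invariant measure: a probability vector is $p=(p_1,\dots,p_N)$ with all $p_i>0$ and $\sum p_i=1$. The invariant measure of $F$ associated with $p$ is the unique Borel probability measure $\mu_F$ on $A$ with $\mu_F(B)=\sum_{i=1}^N p_i\,\mu_F(f_i^{-1}(B))$ for all Borel $B\subset A$. Inner product: $\langle\psi,\varphi\rangle_F=\int_{A_F}\overline{\psi}\,\varphi\,d\mu_F$ on $L^2_F$, and similarly for $G$. *)

(* Defs.v *)
From HB Require Import structures.
From mathcomp Require Import all_boot all_order all_algebra.
From mathcomp Require Import generic_quotient ring_quotient.
From mathcomp Require Import all_classical all_reals all_analysis.
From mathcomp Require Import measurable_realfun complex.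

Set Implicit Arguments.
Unset Strict Implicit.
Unset Printing Implicit Defensive.

Import Order.TTheory GRing.Theory Num.Theory.
Import numFieldNormedType.Exports.

Local Open Scope classical_set_scope.
Local Open Scope ring_scope.

(** * Iterated function systems *)

(* The point is only a witness of nonemptiness (measurable types are pointed
   in the library). *)
#[short(type="pmetricType")]
HB.structure Definition PointedMetric (K : numDomainType) :=
  {T of Pointed T & Metric K T}.

Notation borel T := (g_sigma_algebraType (@open T)).

(* [f] is a homeomorphism of [X] onto [range f] with the subspace topology. *)
Definition homeo_onto_image (X Y : topologicalType) (f : X -> Y) : Prop :=
  continuous f /\
  exists g : Y -> X, cancel f g /\ {within range f, continuous g}.

(* The system has [n.+1] maps, indexed by ['I_n.+1 = {0, ..., n}]; there is no
   IFS without maps, since the space is nonempty and covered by the images. *)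
Record IFS (R : realType) (n : nat) := MkIFS {
  attractor :> pmetricType R ;
  ifs_map : 'I_n.+1 -> attractor -> attractor ;
  ifs_compact : compact [set: attractor] ;
  ifs_homeo : forall i, homeo_onto_image (ifs_map i) ;
  ifs_contraction : exists l : R, [/\ 0 <= l, l < 1 &
    forall i x y, mdist (ifs_map i x) (ifs_map i y) <= l * mdist x y] ;
  ifs_attractor : [set: attractor] = \bigcup_i range (ifs_map i)
}.
Arguments ifs_map {R n} F i x : rename.

Unset Implicit Arguments.

Section ifs.
Context {R : realType} {n : nat}.
Implicit Types F G : IFS R n.

Definition ifs_preimage F (U : set F) : set F :=
  \bigcup_i (ifs_map F i @^-1` U).

Definition critical_set F : set F :=
  \bigcup_(ij in [set ij : 'I_n.+1 * 'I_n.+1 | ij.1 != ij.2])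
    (range (ifs_map F ij.1) `&` range (ifs_map F ij.2)).

Definition dynamical_boundary F : set F :=
  closure (\bigcup_(k in [set k | (0 < k)%N])
             iter k (ifs_preimage F) (critical_set F)).

Definition nonoverlapping F : Prop := [set: F] <> dynamical_boundary F.

Definition code : Type := nat -> 'I_n.+1.

(* [f_(s 0) \o ... \o f_(s k.-1)] *)
Fixpoint ifs_word F (s : code) (k : nat) : F -> F :=
  if k is m.+1 then ifs_word F s m \o ifs_map F (s m) else id.

(* The limit does not depend on the starting point [a]. *)
Definition coding_map F (s : code) : F :=
  get [set x : F | forall a : F, ifs_word F s k a @[k --> \oo] --> x].

(* Lexicographic order for the alphabet ordered by [0 > 1 > ... > n]: at the
   first difference, the greater sequence has the smaller index. *)
Definition code_gt (s t : code) : Prop :=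
  exists k, (forall j, (j < k)%N -> s j = t j) /\ (s k < t k)%N.

Definition code_max (S : set code) : set code :=
  [set s | S s /\ forall t, S t -> t <> s -> code_gt s t].

Definition top_section F (x : F) : code :=
  xget (fun=> ord0) (code_max [set s | coding_map F s = x]).

Definition fractal_transformation F G : F -> G :=
  coding_map G \o top_section F.

Definition probability_vector (p : 'I_n.+1 -> R) : Prop :=
  (forall i, 0 < p i) /\ \sum_i p i = 1.

Definition invariant_measure F (p : 'I_n.+1 -> R)
    (mu : probability (borel F) R) : Prop :=
  forall B : set (borel F), measurable B ->
    (mu B = \sum_i (p i)%:E * mu (ifs_map F i @^-1` B))%E.

End ifs.

Set Implicit Arguments.

(** * Complex-valued square integrable functions *)

Local Notation normc := (@ComplexField.Normc.normc _).

Section L2.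
Context d (T : measurableType d) (R : realType).
Variable mu : {measure set T -> \bar R}.
Implicit Types f g : T -> R[i].

(* The library has neither Borel sets of [R[i]] nor integrals of complex-valued
   functions: both are taken componentwise. *)
Definition cmeasurable f : Prop :=
  measurable_fun setT (@complex.Re R \o f) /\
  measurable_fun setT (@complex.Im R \o f).

Definition cintegral f : R[i] :=
  Complex (\int[mu]_x complex.Re (f x)) (\int[mu]_x complex.Im (f x)).

Definition sqint : {pred T -> R[i]} :=
  mem [set f | cmeasurable f /\ finite_norm mu 2%:E (normc \o f)].

Lemma cmeasurable_cst (a : R[i]) : cmeasurable (cst a).
Proof. by split; exact: measurable_cst. Qed.

Lemma cmeasurableD f g : cmeasurable f -> cmeasurable g -> cmeasurable (f + g).
Proof.
move=> [fr fi] [gr gi]; split.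
- rewrite (_ : _ \o _ = (@complex.Re R \o f) \+ (@complex.Re R \o g)).
    exact: measurable_funD.
  by apply/funext => x /=; rewrite addrfctE; case: (f x) (g x) => [? ?] [].
- rewrite (_ : _ \o _ = (@complex.Im R \o f) \+ (@complex.Im R \o g)).
    exact: measurable_funD.
  by apply/funext => x /=; rewrite addrfctE; case: (f x) (g x) => [? ?] [].
Qed.

Lemma cmeasurableM f g : cmeasurable f -> cmeasurable g ->
  cmeasurable (fun x => f x * g x).
Proof.
move=> [fr fi] [gr gi]; split.
- rewrite (_ : _ \o _ = ((@complex.Re R \o f) \* (@complex.Re R \o g)) \-
     ((@complex.Im R \o f) \* (@complex.Im R \o g))).
    by apply: measurable_funB; exact: measurable_funM.
  by apply/funext => x /=; case: (f x) (g x) => [? ?] [].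
- rewrite (_ : _ \o _ = ((@complex.Re R \o f) \* (@complex.Im R \o g)) \+
     ((@complex.Im R \o f) \* (@complex.Re R \o g))).
    by apply: measurable_funD; exact: measurable_funM.
  by apply/funext => x /=; case: (f x) (g x) => [? ?] [? ?] /=; rewrite addrC.
Qed.

Lemma cmeasurable_conj f : cmeasurable f -> cmeasurable (fun x => (f x)^*%C).
Proof.
move=> [fr fi]; split.
- by rewrite (_ : _ \o _ = @complex.Re R \o f)//; apply/funext => x /=; case: (f x).
- rewrite (_ : _ \o _ = \- (@complex.Im R \o f)); first exact: measurable_funN.
  by apply/funext => x /=; case: (f x).
Qed.

Lemma measurable_normc f : cmeasurable f -> measurable_fun setT (normc \o f).
Proof.
move=> [fr fi].
rewrite (_ : _ \o _ = @Num.sqrt R \o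
  (fun x => (complex.Re (f x)) ^+ 2 + (complex.Im (f x)) ^+ 2)); last first.
  by apply/funext => x /=; case: (f x).
apply: measurableT_comp.
  by apply: continuous_measurable_fun; exact: sqrt_continuous.
by apply: measurable_funD; apply: measurable_funX; [exact: fr|exact: fi].
Qed.

Lemma sqintP f : reflect (cmeasurable f /\ finite_norm mu 2%:E (normc \o f))
  (f \in sqint).
Proof. by apply: (iffP idP); rewrite inE. Qed.

Lemma ae_eq_cintegral f g : cmeasurable f -> cmeasurable g ->
  {ae mu, forall x, f x = g x} -> cintegral f = cintegral g.
Proof.
move=> [fr fi] [gr gi] fg; rewrite /cintegral; congr Complex; congr fine.
- apply: ae_eq_integral => //; [exact/measurable_EFinP..|].
  by apply: filterS fg => x fgx _; rewrite fgx.
- apply: ae_eq_integral => //; [exact/measurable_EFinP..|].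
  by apply: filterS fg => x fgx _; rewrite fgx.
Qed.

Lemma measurable_abs_powe (k : T -> R) : measurable_fun setT k ->
  measurable_fun setT (fun x => (`|(k x)%:E| `^ 2)%E).
Proof.
move=> mk; apply: (@measurableT_comp _ _ _ _ _ _ (fun x => (x `^ 2)%E)).
  exact: measurable_poweR.
by apply: measurableT_comp => //; exact/measurable_EFinP.
Qed.

Lemma finite_norm_le (g h : T -> R) :
  measurable_fun setT g -> measurable_fun setT h ->
  (forall x, `|g x| <= `|h x|) ->
  finite_norm mu 2%:E h -> finite_norm mu 2%:E g.
Proof.
have n20 : 2 != 0 :> R by rewrite pnatr_eq0.
move=> mg mh gh; rewrite /finite_norm => fh.
apply: (@lty_poweRy _ _ 2) => //; rewrite poweR_Lnorm//.
apply: (@le_lt_trans _ _ (\int[mu]_x (`|(h x)%:E| `^ 2))%E); last first.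
  by rewrite -(@poweR_Lnorm _ _ _ mu (EFin \o h) 2)// poweR_lty.
apply: ge0_le_integral => //.
- by move=> x _; exact: poweR_ge0.
- exact: measurable_abs_powe.
- exact: measurable_abs_powe.
- move=> x _; apply: gt0_ler_poweR => //; last by rewrite lee_fin.
  + by rewrite in_itv/= lee_fin normr_ge0 leey.
  + by rewrite in_itv/= lee_fin normr_ge0 leey.
Qed.

Lemma finite_normD (g h : T -> R) :
  measurable_fun setT g -> measurable_fun setT h ->
  finite_norm mu 2%:E g -> finite_norm mu 2%:E h ->
  finite_norm mu 2%:E (g \+ h).
Proof.
move=> mg mh fg fh; apply: (le_lt_trans (minkowski_EFin mu mg mh _)).
  by rewrite ler1n.
by rewrite lte_add_pinfty.
Qed.

Lemma finite_normZ (a : R) (h : T -> R) : measurable_fun setT h ->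
  finite_norm mu 2%:E h -> finite_norm mu 2%:E (a \*: h).
Proof.
move=> mh fh; have p1 : (1 <= 2%:E :> \bar R)%E by rewrite lee_fin ler1n.
have hL : h \in Lfun mu 2%:E by rewrite inE/=; apply/andP; split; rewrite inE.
have : a *: h \in Lfun mu 2%:E.
  by have [_ /(_ a _ 0 hL)] := Lfun_submod_closed mu p1; rewrite addr0; apply;
    have [] := Lfun_submod_closed mu p1.
by rewrite inE => /andP[_]; rewrite inE.
Qed.

Lemma normc_ge0 (z : R[i]) : 0 <= normc z.
Proof. by case: z => a b; exact: sqrtr_ge0. Qed.

Lemma sqint_submod_closed : submod_closed sqint.
Proof.
split.
  apply/sqintP; split; first exact: cmeasurable_cst.
  rewrite /finite_norm (_ : EFin \o _ = cst 0%E).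
    by rewrite Lnorm0 ?ltry// eqe pnatr_eq0.
  by apply/funext => x /=; congr EFin; exact: ComplexField.Normc.normc0.
move=> a f g /sqintP[mf ff] /sqintP[mg fg].
have maf : cmeasurable (a *: f).
  by apply: cmeasurableM mf; exact: cmeasurable_cst.
have mNf := measurable_normc mf; have mNg := measurable_normc mg.
have mafg := cmeasurableD maf mg.
have maNf : measurable_fun setT (normc a \*: (normc \o f)).
  by apply: measurable_funM.
apply/sqintP; split => //.
apply: (@finite_norm_le _ ((normc a \*: (normc \o f)) \+ (normc \o g))).
- exact: measurable_normc.
- exact: measurable_funD.
- move=> x /=; rewrite ger0_norm ?normc_ge0// ger0_norm; last first.
    by rewrite addr_ge0 ?normc_ge0// mulr_ge0 ?normc_ge0.
  by rewrite (le_trans (le_normcD _ _))// ComplexField.Normc.normcM.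
- by apply: finite_normD => //; exact: finite_normZ.
Qed.

HB.instance Definition _ :=
  GRing.isSubmodClosed.Build _ _ sqint sqint_submod_closed.

Record sqfun := Sqfun { sqfun_val :> T -> R[i] ; _ : sqfun_val \in sqint }.

HB.instance Definition _ := [isSub for sqfun_val].
HB.instance Definition _ := [Choice of sqfun by <:].
HB.instance Definition _ := [SubChoice_isSubLmodule of sqfun by <:].

Definition sqnull : {pred sqfun} :=
  mem [set f : sqfun | {ae mu, forall x, f x = 0}].

Lemma sqnullP (f : sqfun) : reflect {ae mu, forall x, f x = 0} (f \in sqnull).
Proof. by apply: (iffP idP); rewrite inE. Qed.

Lemma sqnull_submod_closed : submod_closed sqnull.
Proof.
split; first by apply/sqnullP; apply: nearW.
move=> a f g /sqnullP nf /sqnullP ng; apply/sqnullP.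
apply: filterS2 nf ng => x fx gx.
by rewrite [LHS](_ : _ = a * f x + g x)// fx gx mulr0 addr0.
Qed.

HB.instance Definition _ :=
  GRing.isSubmodClosed.Build _ _ sqnull sqnull_submod_closed.

Definition L2 : Type := Quotient.quot sqnull.
HB.instance Definition _ := GRing.Zmodule.on L2.
HB.instance Definition _ := EqQuotient.on L2.

Local Open Scope quotient_scope.

Lemma L2_eqP (f g : sqfun) :
  reflect {ae mu, forall x, f x = g x} (\pi_L2 f == \pi_L2 g).
Proof.
have fgE x : (f - g) x = f x - g x by [].
rewrite -Quotient.idealrBE; apply: (iffP (sqnullP _)).
  by move=> fg0; apply: filterS fg0 => x; rewrite fgE; exact: subr0_eq.
by move=> fg; apply: filterS fg => x fgx; rewrite fgE fgx subrr.
Qed.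

Lemma L2_reprP (f : sqfun) : {ae mu, forall x, repr (\pi_L2 f) x = f x}.
Proof. by apply/L2_eqP; rewrite reprK. Qed.

Definition L2scale (a : R[i]) (u : L2) : L2 := \pi_L2 (a *: repr u).

Lemma L2scale_pi a (f : sqfun) : L2scale a (\pi_L2 f) = \pi_L2 (a *: f).
Proof.
apply/eqP/L2_eqP; apply: filterS (L2_reprP f) => x fx.
by rewrite [LHS](_ : _ = a * repr (\pi_L2 f) x)// fx.
Qed.

Lemma L2scaleA a b u : L2scale a (L2scale b u) = L2scale (a * b) u.
Proof. by rewrite -[u]reprK (L2scale_pi b) !L2scale_pi scalerA. Qed.

Lemma L2scale1 : left_id 1 L2scale.
Proof. by move=> u; rewrite -[u]reprK L2scale_pi scale1r. Qed.

Lemma L2scaleDr : right_distributive L2scale +%R.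
Proof.
move=> a u v; rewrite -[u]reprK -[v]reprK -raddfD !L2scale_pi.
by rewrite scalerDr raddfD.
Qed.

Lemma L2scaleDl u : {morph L2scale^~ u : a b / a + b}.
Proof. by move=> a b; rewrite -[u]reprK !L2scale_pi scalerDl raddfD. Qed.

HB.instance Definition _ := GRing.Zmodule_isLmodule.Build R[i] L2
  L2scaleA L2scale1 L2scaleDr L2scaleDl.

(* Class of [f]; the value [0] for [f] not in [sqint] is a dummy. *)
Definition L2class f : L2 := \pi_L2 (insubd 0 f).

Definition L2norm (u : L2) : R := fine 'N[mu]_2%:E[EFin \o (normc \o repr u)].

Definition L2inner (u v : L2) : R[i] :=
  cintegral (fun x => (repr u x)^*%C * repr v x).

Lemma L2class_repr (u : L2) : L2class (repr u) = u.
Proof. by rewrite /L2class valKd reprK. Qed.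

Lemma repr_L2class f : f \in sqint ->
  {ae mu, forall x, repr (L2class f) x = f x}.
Proof.
move=> fP; apply: filterS (L2_reprP (insubd 0 f)) => x ->.
by rewrite -[sqfun_val _]/(val _) insubdK.
Qed.

Lemma L2norm_class f : f \in sqint ->
  L2norm (L2class f) = fine 'N[mu]_2%:E[EFin \o (normc \o f)].
Proof.
move=> fP; have /sqintP[mf _] := fP.
have /sqintP[mrf _] := valP (repr (L2class f)).
have LnormE h : ('N[mu]_2%:E[h])%E = ((\int[mu]_x `|h x| `^ 2) `^ 2^-1)%E.
  by rewrite unlock.
rewrite /L2norm !LnormE; congr (fine (_ `^ _)%E).
apply: ae_eq_integral => //.
- exact: (measurable_abs_powe (measurable_normc mrf)).
- exact: (measurable_abs_powe (measurable_normc mf)).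
- by apply: filterS (repr_L2class fP) => x fx _; rewrite /= fx.
Qed.

Lemma L2inner_class f g : f \in sqint -> g \in sqint ->
  L2inner (L2class f) (L2class g) = cintegral (fun x => (f x)^*%C * g x).
Proof.
move=> fP gP; have /sqintP[mf _] := fP; have /sqintP[mg _] := gP.
have /sqintP[mrf _] := valP (repr (L2class f)).
have /sqintP[mrg _] := valP (repr (L2class g)).
apply: ae_eq_cintegral.
- by apply: cmeasurableM => //; exact: cmeasurable_conj.
- by apply: cmeasurableM => //; exact: cmeasurable_conj.
- by apply: filterS2 (repr_L2class fP) (repr_L2class gP) => x -> ->.
Qed.

End L2.

Section composition.
Context d d' (X : measurableType d) (Y : measurableType d') (R : realType).
Variables (mu : {measure set X -> \bar R}) (nu : {measure set Y -> \bar R}).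

(* [phi |-> phi \o T] on classes. The formula goes through a representative,
   so it is the intended operator only for [T] with [comp_well_defined T]. *)
Definition comp_operator (T : Y -> X) (u : L2 mu) : L2 nu :=
  L2class nu (repr u \o T).

Definition comp_well_defined (T : Y -> X) : Prop :=
  forall f : X -> R[i], f \in sqint mu ->
    f \o T \in sqint nu /\
    comp_operator T (L2class mu f) = L2class nu (f \o T).

End composition.
Arguments comp_operator {d d' X Y R} mu nu T u.
Arguments comp_well_defined {d d' X Y R} mu nu T.

(* Main.v *)
From HB Require Import structures.
Require Import Defs.
From mathcomp Require Import all_boot all_order all_algebra.
From mathcomp Require Import all_classical all_reals all_analysis.
From mathcomp Require Import measurable_realfun complex ring.

Set Implicit Arguments.
Unset Strict Implicit.
Unset Printing Implicit Defensive.

Import Order.TTheory GRing.Theory Num.Theory.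
Import numFieldNormedType.Exports.

Local Open Scope classical_set_scope.
Local Open Scope ring_scope.

(** Let [m x] be the least [i] with [x] in the image of [f_i], and let
    [S x = f_(m x)^-1 x]. The largest code of [x] is its itinerary
    [k |-> m (S^k x)], which makes the top section measurable.

    Nonoverlapping makes the preimages [f_i^-1 C] of the critical set null:
    some word [w] maps the attractor into the complement of the dynamical
    boundary, so [f_w^-1 (f_v^-1 C)] is empty for every nonempty word [v], and
    invariance of the measure then bounds the measure of [f_v^-1 C] by every
    power of [1 - p_w]. Off these null sets the itinerary of [f_i x] is [i]
    followed by that of [x], so the law of the itinerary is the Bernoulli
    measure of [p]: it is the same for [F] and for [G]. Hence the fractal
    transformations preserve the measures. They are mutually inverse almost
    everywhere, because almost every itinerary in [F] is also the largest code
    of its point in [G]. *)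

(** * Composition with measure-preserving maps *)

Section L2class.
Context d (T : measurableType d) (R : realType).
Variable mu : {measure set T -> \bar R}.
Implicit Types (f g : T -> R[i]) (u v : L2 mu).

Lemma L2class_eq f g : f \in sqint mu -> g \in sqint mu ->
  {ae mu, forall x, f x = g x} -> L2class mu f = L2class mu g.
Proof.
move=> fP gP fg; apply/eqP/L2_eqP; apply: filterS fg => y.
by rewrite -![sqfun_val _]/(val _) !insubdK.
Qed.

Lemma L2classP a f g : f \in sqint mu -> g \in sqint mu ->
  L2class mu (a *: f + g) = a *: L2class mu f + L2class mu g.
Proof.
move=> fP gP; rewrite -[a *: L2class mu f]/(L2scale a _) L2scale_pi -raddfD.
congr (\pi_(L2 mu) _)%qT; apply: val_inj => /=.
rewrite -[LHS]/(val _) insubdK; last by rewrite rpredD ?rpredZ.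
by rewrite -[RHS]/(a *: val (insubd 0 f) + val (insubd 0 g)) !insubdK.
Qed.

(** The representative of a combination is chosen anew by the quotient, so linearity survives only
    almost everywhere. *)
Lemma repr_L2P a u v :
  {ae mu, forall x, repr (a *: u + v) x = a * repr u x + repr v x}.
Proof.
have sqP (w : L2 mu) : sqfun_val (repr w) \in sqint mu by exact: valP.
have -> : a *: u + v =
    L2class mu (a *: sqfun_val (repr u) + sqfun_val (repr v)).
  by rewrite L2classP// !L2class_repr.
by apply: repr_L2class; rewrite rpredD ?rpredZ.
Qed.

End L2class.

Section measure_preserving.
Context d d' (X : measurableType d) (Y : measurableType d') (R : realType).
Variables (mu : {measure set X -> \bar R}) (nu : {measure set Y -> \bar R}).
Implicit Types f g : X -> R[i].

(** The measure on the target comes before the one on the source, in the order used by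
    [comp_operator]. *)
Definition measure_preserving (T : Y -> X) : Prop :=
  measurable_fun setT T /\
  forall B, measurable B -> nu (T @^-1` B) = mu B.

Variable T : Y -> X.
Hypothesis mpT : measure_preserving T.

Let mT : measurable_fun setT T := mpT.1.

Lemma ge0_integral_comp (f : X -> \bar R) :
  measurable_fun setT f -> (forall x, 0 <= f x)%E ->
  (\int[nu]_y f (T y) = \int[mu]_x f x)%E.
Proof.
move=> mf f0; have [_ nuT] := mpT.
rewrite -[LHS](@ge0_integral_pushforward _ _ _ _ _ T mT nu setT f)//.
by apply: eq_measure_integral => A mA _; exact: nuT.
Qed.

(** No integrability is assumed: the positive and negative parts are transported separately. *)
Lemma integral_comp (f : X -> \bar R) : measurable_fun setT f ->
  (\int[nu]_y f (T y) = \int[mu]_x f x)%E.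
Proof.
move=> mf; rewrite (integralE mu) (integralE nu).
congr (_ - _)%E.
- rewrite -(@ge0_integral_comp f^\+%E)//; last exact: measurable_funepos.
  by apply: eq_integral => y _; rewrite !funeposE.
- rewrite -(@ge0_integral_comp f^\-%E)//; last exact: measurable_funeneg.
  by apply: eq_integral => y _; rewrite !funenegE.
Qed.

Lemma ae_comp (P : X -> Prop) : {ae mu, forall x, P x} ->
  {ae nu, forall y, P (T y)}.
Proof.
have [_ nuT] := mpT.
move=> [B [mB B0 PB]]; exists (T @^-1` B); split.
- by rewrite -[X in measurable X]setTI; exact: mT.
- by rewrite nuT.
- by move=> y /= nPy; exact: PB.
Qed.

Lemma cmeasurable_comp f : cmeasurable f -> cmeasurable (f \o T).
Proof.
by move=> [fr fi]; split;
  [exact: (measurableT_comp fr mT)|exact: (measurableT_comp fi mT)].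
Qed.

Lemma cintegral_comp f : cmeasurable f ->
  cintegral nu (f \o T) = cintegral mu f.
Proof.
move=> [fr fi]; congr Complex; congr fine.
- by apply: (@integral_comp (EFin \o (@complex.Re R \o f)));
  exact/measurable_EFinP.
- by apply: (@integral_comp (EFin \o (@complex.Im R \o f)));
  exact/measurable_EFinP.
Qed.

Local Notation normc := (@ComplexField.Normc.normc _).

Lemma Lnorm_comp f : cmeasurable f ->
  ('N[nu]_2%:E[EFin \o (normc \o (f \o T))] =
   'N[mu]_2%:E[EFin \o (normc \o f)])%E.
Proof.
move=> mf; have /measurable_abs_powe mNf := measurable_normc mf.
rewrite unlock; congr (_ `^ _)%E.
by have := ge0_integral_comp mNf (fun x => poweR_ge0 _ _).
Qed.

Lemma sqint_comp f : f \in sqint mu -> f \o T \in sqint nu.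
Proof.
move=> /sqintP[mf ff]; apply/sqintP; split; first exact: cmeasurable_comp.
by rewrite /finite_norm Lnorm_comp.
Qed.

(** Preimages of null sets under [T] are null, so changing the representative changes the composite
    only on a null set. *)
Lemma comp_operator_well_defined : comp_well_defined mu nu T.
Proof.
move=> f fP; split; first exact: sqint_comp.
apply: L2class_eq; [|exact: sqint_comp|exact: ae_comp (repr_L2class fP)].
exact/sqint_comp/valP.
Qed.

Lemma comp_operator_class f : f \in sqint mu ->
  comp_operator mu nu T (L2class mu f) = L2class nu (f \o T).
Proof. by case/comp_operator_well_defined. Qed.

Lemma comp_operator_norm u : L2norm (comp_operator mu nu T u) = L2norm u.
Proof.
have /sqintP[mru _] := valP (repr u).
by rewrite L2norm_class ?Lnorm_comp//; exact/sqint_comp/valP.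
Qed.

Lemma comp_operator_linear : linear (comp_operator mu nu T).
Proof.
move=> a u v.
have sqP (w : L2 mu) : sqfun_val (repr w) \in sqint mu by exact: valP.
have aucT : a *: (repr u \o T) + (repr v \o T) \in sqint nu.
  by rewrite rpredD ?rpredZ ?sqint_comp ?sqP.
apply: (@etrans _ _ (L2class nu (a *: (repr u \o T) + (repr v \o T)))).
  apply: L2class_eq => //; first exact/sqint_comp/sqP.
  exact: ae_comp (repr_L2P a u v).
by rewrite L2classP ?sqint_comp ?sqP.
Qed.

End measure_preserving.

Section measure_isomorphism.
Context d d' (X : measurableType d) (Y : measurableType d') (R : realType).
Variables (mu : {measure set X -> \bar R}) (nu : {measure set Y -> \bar R}).
Variables (S : X -> Y) (T : Y -> X).
Hypothesis mpS : measure_preserving nu mu S.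
Hypothesis mpT : measure_preserving mu nu T.
Hypothesis STK : {ae mu, forall x, T (S x) = x}.

Lemma comp_operatorK u :
  comp_operator nu mu S (comp_operator mu nu T u) = u.
Proof.
have uP : sqfun_val (repr u) \in sqint mu by exact: valP.
rewrite -[RHS]L2class_repr -[u in LHS]L2class_repr.
have uTP := sqint_comp mpT uP.
rewrite (comp_operator_class mpT)// (comp_operator_class mpS)//.
apply: L2class_eq => //; first exact: (sqint_comp mpS).
by apply: filterS STK => x /= ->.
Qed.

(** The left integral over [Y] is pulled back along [S]; its integrand then contains [phi] at
    [T (S x)], which is [x] almost everywhere. *)
Lemma L2inner_comp_operator (psi : L2 nu) (phi : L2 mu) :
  L2inner psi (comp_operator mu nu T phi) =
  L2inner (comp_operator nu mu S psi) phi.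
Proof.
have psiP : sqfun_val (repr psi) \in sqint nu by exact: valP.
have phiP : sqfun_val (repr phi) \in sqint mu by exact: valP.
have /sqintP[mpsi _] := psiP; have /sqintP[mphi _] := phiP.
rewrite -[psi in LHS]L2class_repr -[phi in RHS]L2class_repr.
have psiSP := sqint_comp mpS psiP; have phiTP := sqint_comp mpT phiP.
rewrite !L2inner_class//.
have mf : cmeasurable (fun y => (repr psi y)^*%C * repr phi (T y)).
  apply: cmeasurableM; [exact: cmeasurable_conj|exact: (cmeasurable_comp mpT)].
rewrite -(cintegral_comp mpS mf); apply: ae_eq_cintegral.
- exact: (cmeasurable_comp mpS).
- by apply: cmeasurableM mphi; apply/cmeasurable_conj/(cmeasurable_comp mpS).
- by apply: filterS STK => x /= ->.
Qed.

End measure_isomorphism.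

(** * Code space *)

Section code_space.
Variable n : nat.
Implicit Types s t : @Defs.code n.

HB.instance Definition _ := isPointed.Build 'I_n.+1 ord0.

(** The prefix is carried by a whole sequence, so that any member of a cylinder can serve as its
    center. *)
Definition cylinder s k : set (nat -> 'I_n.+1) :=
  [set t | forall j, (j < k)%N -> t j = s j].

(** Cylinders with incompatible prefixes are disjoint; the empty set is included to get closure
    under intersection. *)
Definition cylinders : set (set (nat -> 'I_n.+1)) :=
  [set A | A = set0 \/ exists s k, A = cylinder s k].

Definition code_space := g_sigma_algebraType cylinders.

HB.instance Definition _ := Measurable.on code_space.

Lemma cylinder_measurable s k : measurable (cylinder s k : set code_space).
Proof. by apply: sub_sigma_algebra; right; exists s, k. Qed.

Lemma cylinder_eq s t k : cylinder s k t -> cylinder s k = cylinder t k.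
Proof.
by move=> st; apply/seteqP; split => u su j jk; rewrite su// st.
Qed.

Lemma cylinders_setI : setI_closed cylinders.
Proof.
move=> A B [->|[s [k ->]]]; first by rewrite set0I; left.
move=> [->|[t [m ->]]]; first by rewrite setI0; left.
have [->|/set0P[u [su tu]]] := eqVneq (cylinder s k `&` cylinder t m) set0.
  by left.
right; exists u, (maxn k m); rewrite (cylinder_eq su) (cylinder_eq tu).
apply/seteqP; split => [v [uv1 uv2] j|v uv].
  by rewrite leq_max => /orP[/uv1|/uv2].
by split=> j jk; apply: uv; rewrite leq_max jk ?orbT.
Qed.

(** Such a set is a finite union of cylinders, one for each prefix of length [k] that occurs in
    it. *)
Lemma prefix_measurable k (A : set code_space) :
  (forall s t, (forall j, (j < k)%N -> s j = t j) -> A s -> A t) ->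
  measurable A.
Proof.
move=> Ak.
have -> : A = \bigcup_(v in [set v : {ffun 'I_k -> 'I_n.+1} |
    exists2 s, A s & forall j : 'I_k, s j = v j])
      \bigcap_(j in [set: 'I_k]) [set s : code_space | s j = v j].
  apply/seteqP; split => s.
    by move=> As; exists [ffun j : 'I_k => s j] => [|j _] /=;
      [exists s => // j|]; rewrite ffunE.
  by move=> [v [t At tv] sv]; apply: Ak At => j jk;
    rewrite (tv (Ordinal jk)) (sv (Ordinal jk)).
apply: fin_bigcup_measurable; first exact: finite_finset.
move=> v [s As sv].
rewrite (_ : \bigcap_(j in _) _ = cylinder s k);
  first exact: cylinder_measurable.
apply/seteqP; split => [t tv j jk|t st j _ /=].
  by rewrite (sv (Ordinal jk)) -(tv (Ordinal jk)).
by rewrite -sv st.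
Qed.

End code_space.

(** * Coding map and itineraries *)

Section attractor.
Context {R : realType} {n : nat} (F : IFS R n).
Implicit Types (i : 'I_n.+1) (j k : nat) (s t : @Defs.code n) (x y : F).

Local Notation f := (ifs_map F).

Lemma ifs_map_continuous i : continuous (f i).
Proof. by have [] := ifs_homeo F i. Qed.

Lemma ifs_map_inj i : injective (f i).
Proof. by have [_ [g [fK _]]] := ifs_homeo F i; exact: can_inj fK. Qed.

Lemma ifs_hausdorff : hausdorff_space F.
Proof. exact: metric_hausdorff. Qed.

Lemma ifs_image_closed i (K : set F) : closed K -> closed (f i @` K).
Proof.
move=> cK; apply: (compact_closed ifs_hausdorff).
have cptK : compact K.
  exact: subclosed_compact cK (@ifs_compact _ _ F) (@subsetT _ K).
exact: continuous_compact (continuous_subspaceT (@ifs_map_continuous i)) cptK.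
Qed.

Lemma ifs_range_closed i : closed (range (f i)).
Proof. exact/ifs_image_closed/closedT. Qed.

Lemma ifs_bounded : exists M : R, 0 < M /\ forall x y, mdist x y < M.
Proof.
have /compact_near_coveringP := @ifs_compact _ _ F.
(* Near each point all large [k] bound the distance to [point]; compactness yields one [k] for the
   whole space. *)
move=> /(_ nat \oo (fun k x => mdist (point : F) x < k%:R) _)[x _|k _ /(_ k)].
  exists (ball x 1, [set k | mdist (point : F) x + 1 < k%:R]).
    by split; [exact: nbhsx_ballx|exact: nbhs_infty_gtr].
  move=> [y k] /= []; rewrite ballEmdist/= => xy xk.
  by rewrite (le_lt_trans (metric_triangle _ x _))// (lt_trans _ xk)// ltrD2l.
move=> /(_ (leqnn k)) kM; exists (k%:R + k%:R); split.
  have := kM point I; rewrite mdistxx => k0.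
  by rewrite addr_gt0.
move=> x y; rewrite (le_lt_trans (metric_triangle _ point _))// ltrD//.
  by rewrite metric_sym; exact: kM.
exact: kM.
Qed.

(** * Words of maps and the coding map *)

Lemma ifs_wordS s k :
  ifs_word F s k.+1 = f (s 0%N) \o ifs_word F (s \o succn) k.
Proof.
elim: k => // k IH.
by rewrite -[LHS]/(ifs_word F s k.+1 \o f (s k.+1)) IH.
Qed.

Lemma ifs_word_prefix s t k : (forall j, (j < k)%N -> s j = t j) ->
  ifs_word F s k = ifs_word F t k.
Proof.
elim: k => //= k IH st; rewrite (st k (ltnSn k)) IH// => j jk.
exact/st/ltnW.
Qed.

Lemma ifs_word_range_closed s k : closed (range (ifs_word F s k)).
Proof.
elim: k s => [|k IH] s; first by rewrite image_id; exact: closedT.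
rewrite ifs_wordS.
rewrite (_ : range _ = f (s 0%N) @` range (ifs_word F (s \o succn) k)).
  exact/ifs_image_closed/IH.
by rewrite image_comp.
Qed.

Lemma ifs_word_range_le s k m : (k <= m)%N ->
  range (ifs_word F s m) `<=` range (ifs_word F s k).
Proof.
move=> /subnKC <-; elim: (m - k)%N => [|d IH]; first by rewrite addn0.
by rewrite addnS => _ [x _ <-]; apply: IH; exists (f (s (k + d)%N) x).
Qed.

Lemma ifs_word_small (e : R) : 0 < e ->
  \forall k \near \oo, forall s x y,
    mdist (ifs_word F s k x) (ifs_word F s k y) < e.
Proof.
move=> e0; have [l [l0 l1 fl]] := ifs_contraction F.
have [M [M0 FM]] := ifs_bounded.
have lip k s x y :
    mdist (ifs_word F s k x) (ifs_word F s k y) <= l ^+ k * mdist x y.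
  elim: k s => [|k IH] s; first by rewrite expr0 mul1r.
  rewrite ifs_wordS /= (le_trans (fl _ _ _))// exprS -mulrA.
  by rewrite ler_wpM2l.
have : geometric M l k @[k --> \oo] --> (0 : R).
  by apply: cvg_geometric; rewrite ger0_norm.
move=> /cvgr_dist_lt => /(_ _ e0); apply: filterS => k + s x y.
rewrite sub0r normrN /= ger0_norm ?mulr_ge0 ?exprn_ge0// 1?ltW//.
apply: le_lt_trans; rewrite (le_trans (lip _ _ _ _))// mulrC.
by rewrite ler_wpM2r ?exprn_ge0// ltW.
Qed.

Lemma ifs_word_cvg s x : (forall k, range (ifs_word F s k) x) ->
  forall a, ifs_word F s k a @[k --> \oo] --> x.
Proof.
move=> sx a; apply/cvg_ballP => e e0.
apply: filterS (ifs_word_small e0) => k ke.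
by have [y _ <-] := sx k; rewrite ballEmdist /=; exact: ke.
Qed.

(** By compactness the images of [point] under the words cluster somewhere; since the ranges are
    closed and decreasing, each contains the cluster point. *)
Lemma ex_ifs_word_bigcap s : exists x, forall k, range (ifs_word F s k) x.
Proof.
have [|x [_ sx]] := @ifs_compact _ _ F (ifs_word F s k point @[k --> \oo]) _.
  exact: filterT.
exists x => k; apply: (@ifs_word_range_closed s k) => U Ux.
apply: sx Ux; exists k => // m /= km.
by apply: (ifs_word_range_le km); exists point.
Qed.

(** This replaces the limit in [coding_map] by membership in the nested ranges; uniqueness of limits
    makes [get] return [x]. *)
Lemma coding_map_eq s x : (forall k, range (ifs_word F s k) x) ->
  coding_map F s = x.
Proof.
move=> sx; apply: xget_subset1; first exact: ifs_word_cvg.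
move=> y z sy sz.
exact: (cvg_unique ifs_hausdorff (sy point) (sz point)).
Qed.

Lemma ifs_word_coding_map s k : range (ifs_word F s k) (coding_map F s).
Proof. by have [x sx] := ex_ifs_word_bigcap s; rewrite (coding_map_eq sx). Qed.

Lemma coding_mapS s : coding_map F s = f (s 0%N) (coding_map F (s \o succn)).
Proof.
apply: coding_map_eq => -[|k];
  first by exists (f (s 0%N) (coding_map F (s \o succn))).
have [x _ <-] := ifs_word_coding_map (s \o succn) k.
by exists x => //; rewrite ifs_wordS.
Qed.

(** * Itineraries and the top section *)

Lemma ex_first_digit x : exists i,
  range (f i) x /\ forall i', range (f i') x -> (i <= i')%N.
Proof.
have [i _ ix] : (\bigcup_i range (f i)) x by rewrite -ifs_attractor.
have iP : `[< range (f i) x >] by exact/asboolP.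
case: (@arg_minnP _ i (fun i' => `[< range (f i') x >]) (@nat_of_ord _) iP) =>
  i0 /asboolP i0x i0P.
by exists i0; split => // i' /asboolP; exact: i0P.
Qed.

(** The least index is the greatest symbol for [code_gt]. *)
Definition first_digit x : 'I_n.+1 := projT1 (cid (ex_first_digit x)).

Lemma first_digit_range x : range (f (first_digit x)) x.
Proof. by rewrite /first_digit; case: cid => i /= []. Qed.

Lemma first_digit_le i x : range (f i) x -> (first_digit x <= i)%N.
Proof. by rewrite /first_digit; case: cid => i0 /= [_]; apply. Qed.

(* The branch of the inverse of the system that reads off the largest code. *)
Definition top_map x : F := get [set y | f (first_digit x) y = x].

Lemma top_mapK x : f (first_digit x) (top_map x) = x.
Proof.
have [y _ yx] := first_digit_range x.
exact: (@getPex _ [set y | f (first_digit x) y = x] (ex_intro _ y yx)).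
Qed.

Definition itinerary x : Defs.code := fun k => first_digit (iter k top_map x).

Lemma ifs_word_itinerary x k :
  ifs_word F (itinerary x) k (iter k top_map x) = x.
Proof. by elim: k => //= k IH; rewrite top_mapK. Qed.

Lemma coding_map_itinerary x : coding_map F (itinerary x) = x.
Proof.
apply: coding_map_eq => k.
by exists (iter k top_map x) => //; exact: ifs_word_itinerary.
Qed.

(** While [s] follows the itinerary, injectivity forces both to undo the same maps, so shifting [s]
    codes the iterates of [top_map]. *)
Lemma iter_top_map_coding s x k : coding_map F s = x ->
  (forall j, (j < k)%N -> s j = itinerary x j) ->
  iter k top_map x = coding_map F (fun j => s (k + j)%N).
Proof.
move=> sx; elim: k => [|k IH] sk; first by rewrite -sx.
apply: (@ifs_map_inj (first_digit (iter k top_map x))).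
rewrite iterS top_mapK [LHS]IH; last by move=> j jk; exact/sk/ltnW.
rewrite coding_mapS addn0 sk// /itinerary.
congr (f _ (coding_map F _)).
by apply/funext => j /=; rewrite addSnnS.
Qed.

(** At the first difference [k], the shift of the rival code [t] still codes the [k]-th iterate of
    [top_map] at [x]. That iterate lies in the image of map [t k], hence its first digit is at most
    [t k]. *)
Lemma code_max_itinerary x :
  code_max [set s | coding_map F s = x] (itinerary x).
Proof.
split; first exact: coding_map_itinerary.
move=> t tx tix.
have /ex_minnP[k tk kP] : exists k, t k != itinerary x k.
  apply/not_existsP => tk; apply: tix; apply: funext => k.
  by apply/eqP/negPn/negP/tk.
have tlt j : (j < k)%N -> t j = itinerary x j.
  by move=> jk; apply/eqP; apply: contraLR jk => /kP; rewrite leqNgt.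
exists k; split=> [j jk|]; first by rewrite tlt.
rewrite ltn_neqAle eq_sym tk first_digit_le//.
rewrite (iter_top_map_coding tx tlt) coding_mapS addn0.
by exists (coding_map F ((fun j => t (k + j)%N) \o succn)).
Qed.

Lemma code_gt_asym s t : code_gt s t -> ~ code_gt t s.
Proof.
move=> [j [js jlt]] [k [ks klt]].
have [jk|kj|jk] := ltngtP j k.
- by rewrite ks// ltnn in jlt.
- by rewrite js// ltnn in klt.
- by rewrite jk in jlt; have := ltn_trans jlt klt; rewrite ltnn.
Qed.

Lemma top_sectionE : top_section F = itinerary.
Proof.
apply/funext => x; apply: xget_subset1; first exact: code_max_itinerary.
move=> s t [sx sP] [tx tP]; apply: contrapT => st.
by apply: (@code_gt_asym s t); [apply: sP => // /esym|exact: tP].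
Qed.

(** * Borel measurability *)

Lemma closed_measurable_borel (K : set F) : closed K ->
  measurable (K : set (borel F)).
Proof.
move=> cK; rewrite -[K]setCK; apply: measurableC.
by apply: sub_sigma_algebra; rewrite openC.
Qed.

Lemma closed_measurable_fun d (T : measurableType d) (h : T -> borel F) :
  (forall K : set F, closed K -> measurable (h @^-1` K)) ->
  measurable_fun setT h.
Proof.
move=> hK; apply: (@measurability _ _ _ _ setT h (@open F)) => // _ [U oU <-].
rewrite setTI -[U]setCK preimage_setC; apply: measurableC.
by apply: (hK (~` U)); exact: open_closedC.
Qed.

Lemma ifs_map_measurable i :
  measurable_fun setT (f i : borel F -> borel F).
Proof.
apply: closed_measurable_fun => K cK; apply: closed_measurable_borel.
by apply: closed_comp cK => x _; exact: ifs_map_continuous.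
Qed.

Lemma ifs_map_preimage_measurable i (B : set (borel F)) :
  measurable B -> measurable (f i @^-1` B : set (borel F)).
Proof.
by move=> mB; rewrite -[X in measurable X]setTI; exact: ifs_map_measurable.
Qed.

Lemma critical_set_measurable : measurable (critical_set F : set (borel F)).
Proof.
apply: fin_bigcup_measurable; first exact: finite_finset.
move=> i _; apply: measurableI; apply: closed_measurable_borel;
  exact: ifs_range_closed.
Qed.

Lemma first_digit_measurable i :
  measurable (first_digit @^-1` [set i] : set (borel F)).
Proof.
have -> : first_digit @^-1` [set i] = range (f i) `\`
    \bigcup_(i' in [set i' : 'I_n.+1 | (i' < i)%N]) range (f i').
  apply/seteqP; split => x.
    move=> <-; split; first exact: first_digit_range.
    by move=> [i' /= i'x /first_digit_le]; rewrite leqNgt i'x.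
  move=> [ix i'x]; apply/val_inj/eqP => /=.
  rewrite eqn_leq first_digit_le//= leqNgt; apply/negP => lti.
  by apply: i'x; exists (first_digit x) => //; exact: first_digit_range.
apply: measurableD.
  by apply: closed_measurable_borel; exact: ifs_range_closed.
apply: fin_bigcup_measurable; first exact: finite_finset.
by move=> i' _; apply: closed_measurable_borel; exact: ifs_range_closed.
Qed.

(** Where the first digit is [i], [top_map] inverts [f i], so the preimage of a closed set there is
    cut out by its image under [f i], closed by compactness. *)
Lemma top_map_measurable : measurable_fun setT (top_map : borel F -> borel F).
Proof.
apply: closed_measurable_fun => K cK.
have -> : top_map @^-1` K =
    \bigcup_i (first_digit @^-1` [set i] `&` f i @` K).
  apply/seteqP; split => x.
    move=> Kx; exists (first_digit x) => //; split => //.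
    by exists (top_map x) => //; exact: top_mapK.
  move=> [i _ [/= <- [y Ky fy]]].
  by rewrite (_ : top_map x = y)//; apply: (@ifs_map_inj (first_digit x));
    rewrite top_mapK fy.
apply: fin_bigcup_measurable; first exact: finite_finset.
move=> i _; apply: measurableI; first exact: first_digit_measurable.
apply: closed_measurable_borel; exact: ifs_image_closed.
Qed.

Lemma itinerary_measurable :
  measurable_fun setT (itinerary : borel F -> code_space n).
Proof.
apply: (@measurability _ _ _ _ setT (itinerary : borel F -> code_space n)
  (@cylinders n)) => // _ [_ [->|[s [k ->]]] <-].
  by rewrite preimage_set0 setI0.
rewrite setTI (_ : _ @^-1` _ = \bigcap_(j in `I_k)
    (iter j top_map @^-1` (first_digit @^-1` [set s j]))).
  apply: fin_bigcap_measurable => // j _; rewrite -[X in measurable X]setTI.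
  have miter : measurable_fun setT (iter j top_map : borel F -> borel F).
    elim: j => [|j IH]; first exact: measurable_id.
    exact: measurableT_comp top_map_measurable IH.
  by apply: miter => //; exact: first_digit_measurable.
by apply/seteqP; split => x.
Qed.

(** A code is sent into a closed [K] exactly when the range of each of its finite words meets [K],
    since these ranges shrink to the coded point. Each such condition involves only a finite
    prefix. *)
Lemma coding_map_measurable :
  measurable_fun setT (coding_map F : code_space n -> borel F).
Proof.
apply: closed_measurable_fun => K cK.
have -> : coding_map F @^-1` K =
    \bigcap_k [set s | (range (ifs_word F s k) `&` K !=set0)].
  apply/seteqP; split => s.
    by move=> Ks k _; exists (coding_map F s); split => //;
      exact: ifs_word_coding_map.
  move=> sK /=; apply: cK => U Us.
  have /= := Us; rewrite -nbhs_ballE => -[e /= e0 eU].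
  have [k _ ke] := ifs_word_small e0.
  have [y [[z _ zy] Ky]] := sK k I.
  have [x _ sx] := ifs_word_coding_map s k.
  exists y; split => //; apply: eU.
  by rewrite ballEmdist /= -sx -zy; exact: (ke k (leqnn k)).
apply: bigcapT_measurable => k; apply: (@prefix_measurable _ k) => s t st.
by rewrite /= (ifs_word_prefix st).
Qed.

End attractor.

(** * Law of the itinerary *)

Section itinerary_measure.
Context {R : realType} {n : nat} (F : IFS R n).
Variables (p : 'I_n.+1 -> R) (mu : probability (borel F) R).
Hypothesis F_nonoverlapping : nonoverlapping F.
Hypothesis p_probability : probability_vector p.
Hypothesis mu_invariant : invariant_measure F p mu.
Implicit Types (i : 'I_n.+1) (j k : nat) (s t : @Defs.code n) (x y : F).

Local Notation f := (ifs_map F).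

Lemma ifs_preimage_iter_subset k (A B : set F) : A `<=` B ->
  iter k (ifs_preimage F) A `<=` iter k (ifs_preimage F) B.
Proof.
by move=> AB; elim: k => //= k IH x [i _ /IH iB]; exists i.
Qed.

(** Take a point off the closed boundary and follow its itinerary: the word ranges contain the point
    and eventually fit in a ball avoiding the boundary. *)
Lemma ex_ifs_word_interior : exists s k,
  range (ifs_word F s k) `<=` ~` dynamical_boundary F.
Proof.
have [x0 x0P] : exists x, ~ dynamical_boundary F x.
  apply/existsNP => FT; apply: F_nonoverlapping; apply/seteqP.
  by split => x // _; exact: FT.
have : nbhs x0 (~` dynamical_boundary F).
  apply: open_nbhs_nbhs; split => //; rewrite openC.
  exact: closed_closure.
rewrite -nbhs_ballE => -[e /= e0 eF].
have [k _ ke] := ifs_word_small F e0.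
exists (itinerary x0), k => _ [y _ <-]; apply: eF.
rewrite ballEmdist /= -{1}(ifs_word_itinerary x0 k).
exact: (ke k (leqnn k)).
Qed.

Lemma mu_finE (B : set (borel F)) : measurable B -> mu B = (fine (mu B))%:E.
Proof. by move=> mB; rewrite fineK// fin_num_measure. Qed.

Lemma fine_invariant (B : set (borel F)) : measurable B ->
  fine (mu B) = \sum_i p i * fine (mu (f i @^-1` B)).
Proof.
move=> mB; apply: EFin_inj; rewrite -mu_finE// mu_invariant// -sumEFin.
apply: eq_bigr => i _; rewrite EFinM -mu_finE//.
exact: ifs_map_preimage_measurable.
Qed.

Lemma p_ge0 i : 0 <= p i.
Proof. by have [p0 _] := p_probability; exact/ltW. Qed.

Lemma prod_p_gt0 s k : 0 < \prod_(j < k) p (s j).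
Proof. by have [p0 _] := p_probability; exact: prodr_gt0. Qed.

Lemma prod_p_le1 s k : \prod_(j < k) p (s j) <= 1.
Proof.
have [_ p1] := p_probability.
apply: prodr_ile1 => j _; rewrite p_ge0 -p1 (bigD1 (s j))//=.
by rewrite lerDl sumr_ge0// => i _; exact: p_ge0.
Qed.

(* By invariance [mu B] is a convex combination of the measures of the sets
   [f_v^-1 B], where [v] ranges over the words of length [k]; the word
   [s 0 ... s k.-1] contributes nothing. *)
Lemma avoid_word_le (H : set (set (borel F))) (c : R) s k (B : set (borel F)) :
  0 <= c ->
  (forall A, H A -> measurable A) ->
  (forall A i, H A -> H (f i @^-1` A)) ->
  (forall A, H A -> fine (mu A) <= c) ->
  H B -> ifs_word F s k @^-1` B = set0 ->
  fine (mu B) <= (1 - \prod_(j < k) p (s j)) * c.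
Proof.
move=> c0 mH fH Hc; elim: k s B => [|k IH] s B HB sB.
  by rewrite big_ord0 subrr mul0r -[B]preimage_id [_ @^-1` _]sB measure0.
have [_ p1] := p_probability.
rewrite (fine_invariant (mH _ HB)) (bigD1 (s 0%N))//=.
rewrite (_ : \prod_(_ < k.+1) _ = p (s 0%N) * \prod_(j < k) p ((s \o succn) j));
  last by rewrite big_ord_recl.
rewrite ifs_wordS comp_preimage in sB.
have := IH (s \o succn) _ (fH _ (s 0%N) HB) sB.
set q := \prod_(j < k) _ => sBq.
(* The first symbol of the word receives the inductive bound and every other symbol the bound [c];
   the weights sum to 1. *)
have -> : (1 - p (s 0%N) * q) * c =
    p (s 0%N) * ((1 - q) * c) + \sum_(i | i != s 0%N) p i * c.
  rewrite -mulr_suml.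
  by move: p1; rewrite (bigD1 (s 0%N))//= => /(canRL (addKr _)) ->; ring.
rewrite lerD// ?ler_wpM2l ?p_ge0//.
by apply: ler_sum => i _; rewrite ler_wpM2l ?p_ge0 ?Hc//; exact: fH.
Qed.

(** All members of [H] avoid the same word, so a bound common to [H] improves by the factor [q < 1].
    Starting from 1, this can be repeated indefinitely. *)
Lemma avoid_word_null (H : set (set (borel F))) s k (B : set (borel F)) :
  (forall A, H A -> measurable A) ->
  (forall A i, H A -> H (f i @^-1` A)) ->
  (forall A, H A -> ifs_word F s k @^-1` A = set0) ->
  H B -> mu B = 0%E.
Proof.
move=> mH fH sH HB; pose q := 1 - \prod_(j < k) p (s j).
have q0 : 0 <= q by rewrite subr_ge0 prod_p_le1.
have q1 : q < 1 by rewrite ltrBlDr ltrDl prod_p_gt0.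
have Hq m A : H A -> fine (mu A) <= q ^+ m.
  elim: m A => [|m IH] A HA.
    rewrite expr0 -lee_fin -(mu_finE (mH _ HA)).
    by apply: probability_le1; exact: mH.
  by rewrite exprS; apply: (@avoid_word_le H) => //;
    [exact: exprn_ge0|exact: sH].
rewrite (mu_finE (mH _ HB)); congr EFin; apply/eqP.
rewrite eq_le fine_ge0// andbT; apply/ler_addgt0Pl => e e0; rewrite addr0.
have : geometric 1 q m @[m --> \oo] --> (0 : R).
  by apply: cvg_geometric; rewrite ger0_norm.
move=> /cvgr_dist_lt => /(_ _ e0) [m _ /(_ m (leqnn m))].
rewrite sub0r normrN /= mul1r ger0_norm ?exprn_ge0// => /ltW.
exact: le_trans (Hq m _ HB).
Qed.

Lemma critical_set_preimage_null i : mu (f i @^-1` critical_set F) = 0%E.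
Proof.
have [s [k sk]] := ex_ifs_word_interior.
(* Requiring all iterated preimages to stay in the boundary makes [H] stable under each [f i]
   preimage. The boundary collects preimages of the critical set from depth 1 on, which is why one
   map is applied first. *)
pose H : set (set (borel F)) := [set A : set (borel F) |
  measurable A /\
  forall m, iter m (ifs_preimage F) (A : set F) `<=` dynamical_boundary F].
apply: (@avoid_word_null H s k).
- by move=> A [].
- move=> A i' [mA Ad]; split; first exact: ifs_map_preimage_measurable.
  move=> m; apply: subset_trans (Ad m.+1); rewrite iterSr.
  by apply: ifs_preimage_iter_subset => x Ax; exists i'.
- move=> A [_ Ad]; rewrite -subset0 => x Ax.
  by have := sk _ (imageT _ x); apply; exact: (Ad 0%N).
- split.
    by apply: ifs_map_preimage_measurable; exact: critical_set_measurable.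
  move=> m x mx; apply: subset_closure; exists m.+1 => //.
  rewrite iterSr; apply: (ifs_preimage_iter_subset _ mx) => y iy.
  by exists i.
Qed.

(** Off the critical set, [i] is the only index whose image contains [f i x], so [top_map] undoes
    exactly [f i]. *)
Lemma itinerary_ifs_map i x : ~ critical_set F (f i x) ->
  itinerary (f i x) 0 = i /\ itinerary (f i x) \o succn = itinerary x.
Proof.
move=> ncr; have di : first_digit (f i x) = i.
  apply/eqP/negPn/negP => di; apply: ncr.
  by exists (first_digit (f i x), i) => //; split;
    [exact: first_digit_range|exists x].
have tm : top_map (f i x) = x.
  by apply: (@ifs_map_inj _ _ F i); rewrite -{1}di top_mapK.
split => //; apply/funext => k.
by rewrite /itinerary /= -iterS iterSr tm.
Qed.

Lemma itinerary_cylinder s k :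
  mu (itinerary (F := F) @^-1` cylinder s k) = (\prod_(j < k) p (s j))%:E.
Proof.
have mcyl t m :
    measurable (itinerary (F := F) @^-1` cylinder t m : set (borel F)).
  rewrite -[X in measurable X]setTI.
  by apply: itinerary_measurable => //; exact: cylinder_measurable.
elim: k s => [|k IH] s.
  by rewrite big_ord0 (_ : _ @^-1` _ = setT) ?probability_setT//; exact/seteqP.
rewrite mu_invariant// (bigD1 (s 0%N))//= big1 ?adde0 => [|i si].
  rewrite big_ord_recl EFinM -[in RHS](IH (s \o succn)); congr (_ * _)%E.
  have mC : measurable (f (s 0%N) @^-1` critical_set F : set (borel F)).
    by apply: ifs_map_preimage_measurable; exact: critical_set_measurable.
  have mB := ifs_map_preimage_measurable (s 0%N) (mcyl s k.+1).
  (* The two sets agree only off the preimage of the critical set; adjoining this null set to both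
     makes them equal. *)
  rewrite -(measureU0 mB mC); last exact: critical_set_preimage_null.
  rewrite -[RHS](measureU0 (mcyl _ _) mC);
    last exact: critical_set_preimage_null.
  congr (mu _); apply/seteqP; split => x [|]; [|by right| |by right].
    have [?|ncr] := pselect (critical_set F (f (s 0%N) x)); first by right.
    have [_ eS] := itinerary_ifs_map ncr.
    by move=> sx; left => j jk; rewrite -eS; exact: (sx j.+1).
  have [?|ncr] := pselect (critical_set F (f (s 0%N) x)); first by right.
  have [e0 eS] := itinerary_ifs_map ncr.
  by move=> sx; left => -[|j] // jk; have := sx j jk; rewrite -eS.
(* For [i] other than [s 0], a point of the preimage must be mapped by [f i] into the critical
   set. *)
rewrite (_ : mu _ = 0%E) ?mule0//;
  apply: subset_measure0 (critical_set_preimage_null i).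
- exact: ifs_map_preimage_measurable.
- by apply: ifs_map_preimage_measurable; exact: critical_set_measurable.
move=> x sx; apply: contrapT => /itinerary_ifs_map[e0 _].
by move/eqP: si; apply; rewrite -(sx 0%N)// e0.
Qed.

End itinerary_measure.

(** * Fractal transformations *)

Section fractal_transformation.
Context {R : realType} {n : nat} (F G : IFS R n).
Variable p : 'I_n.+1 -> R.
Variables (muF : probability (borel F) R) (muG : probability (borel G) R).
Hypothesis F_nonoverlapping : nonoverlapping F.
Hypothesis G_nonoverlapping : nonoverlapping G.
Hypothesis p_probability : probability_vector p.
Hypothesis muF_invariant : invariant_measure F p muF.
Hypothesis muG_invariant : invariant_measure G p muG.

(** Both laws give a cylinder the product of the weights of its prefix, and cylinders form an
    intersection-stable generating family. *)
Lemma itinerary_law (B : set (code_space n)) : measurable B ->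
  muF (itinerary (F := F) @^-1` B) = muG (itinerary (F := G) @^-1` B).
Proof.
pose XF : {mfun borel F >-> code_space n} := HB.pack (itinerary (F := F))
  (isMeasurableFun.Build _ _ _ _ _ (@itinerary_measurable _ _ F)).
pose XG : {mfun borel G >-> code_space n} := HB.pack (itinerary (F := G))
  (isMeasurableFun.Build _ _ _ _ _ (@itinerary_measurable _ _ G)).
move=> mB; change (distribution muF XF B = distribution muG XG B).
apply: (@measure_unique _ R (code_space n) (@cylinders n) (fun=> setT) erefl
  (@cylinders_setI n) _ _ (distribution muF XF) (distribution muG XG)
  _ _ B mB) => //.
- by move=> _; right; exists (fun=> ord0), 0%N; exact/esym/seteqP.
- by rewrite bigcup_const.
- move=> _ [->|[s [k ->]]]; first by rewrite !measure0.
  exact: etrans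
    (itinerary_cylinder F_nonoverlapping p_probability muF_invariant s k)
    (esym (itinerary_cylinder G_nonoverlapping p_probability muG_invariant s k)).
- move=> _; apply: le_lt_trans (ltry 1).
  exact: (@probability_le1 _ _ _ (distribution muF XF)).
Qed.

(** The equality of laws replaces the itinerary of [F] by that of [G], which [coding_map G] sends
    back to the original point. *)
Lemma fractal_transformation_measure_preserving :
  measure_preserving muG muF (fractal_transformation F G : borel F -> borel G).
Proof.
rewrite /fractal_transformation top_sectionE; split.
  exact: measurableT_comp (@coding_map_measurable _ _ G)
    (@itinerary_measurable _ _ F).
move=> B mB; have mGB : measurable (coding_map G @^-1` B : set (code_space n)).
  by rewrite -[X in measurable X]setTI; exact: coding_map_measurable.
apply: etrans (itinerary_law mGB) _; congr (muG _).
by apply/seteqP; split => y /=; rewrite coding_map_itinerary.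
Qed.

(* A code is recovered from its point in [G] as soon as it is an itinerary of
   [G], and itineraries of [F] and of [G] have the same law. *)
Lemma fractal_transformationK :
  {ae muF, forall x,
    fractal_transformation G F (fractal_transformation F G x) = x}.
Proof.
pose h : code_space n -> code_space n := itinerary (F := G) \o coding_map G.
have mh : measurable_fun setT h.
  exact: measurableT_comp (@itinerary_measurable _ _ G)
    (@coding_map_measurable _ _ G).
(* The codes moved by [h], written coordinatewise to expose measurability. *)
pose bad : set (code_space n) := \bigcup_k [set s | h s k <> s k].
have mbad : measurable bad.
  apply: bigcupT_measurable => k.
  rewrite (_ : [set _ | _] = ~` \bigcup_i
    ((h @^-1` [set s | s k = i]) `&` [set s | s k = i])).
    have mk i : measurable ([set s | s k = i] : set (code_space n)).
      by apply: (@prefix_measurable _ k.+1) => s t st /= <-; rewrite st.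
    apply: measurableC.
    apply: fin_bigcup_measurable; first exact: finite_finset.
    move=> i _; apply: measurableI => //.
    by rewrite -[X in measurable X]setTI; exact: mh.
  apply/seteqP; split => s /=.
    by move=> hs [i _ [/= hi si]]; apply: hs; rewrite hi si.
  by move=> hs hi; apply: hs; exists (s k).
exists (itinerary (F := F) @^-1` bad); split.
- by rewrite -[X in measurable X]setTI; apply: itinerary_measurable.
(* Under the law computed in [G] no code is bad, because [h] fixes every itinerary of [G]. *)
- rewrite itinerary_law// (_ : _ @^-1` _ = set0) ?measure0//.
  rewrite -subset0 => y [k _]; rewrite /= /h /=.
  by rewrite coding_map_itinerary.
move=> x /= Tx; apply: contrapT => xbad; apply: Tx.
rewrite /fractal_transformation !top_sectionE /=.
have -> : itinerary (coding_map G (itinerary x)) = itinerary x.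
  by apply: funext => k; apply: contrapT => hk; apply: xbad; exists k.
exact: coding_map_itinerary.
Qed.

End fractal_transformation.

Theorem theorem4p1 (R : realType) (n : nat) (F G : IFS R n)
    (p : 'I_n.+1 -> R)
    (muF : probability (borel F) R) (muG : probability (borel G) R)
    (F_nonoverlapping : nonoverlapping F)
    (G_nonoverlapping : nonoverlapping G)
    (p_probability : probability_vector p)
    (muF_invariant : invariant_measure F p muF)
    (muG_invariant : invariant_measure G p muG) :
  let T_FG : borel F -> borel G := fractal_transformation F G in
  let T_GF : borel G -> borel F := fractal_transformation G F in
  let U_FG : L2 muF -> L2 muG := comp_operator muF muG T_GF in
  let U_GF : L2 muG -> L2 muF := comp_operator muG muF T_FG in
  [/\ comp_well_defined muF muG T_GF /\ comp_well_defined muG muF T_FG,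
      (linear U_FG /\ forall phi, L2norm (U_FG phi) = L2norm phi) /\
      (linear U_GF /\ forall phi, L2norm (U_GF phi) = L2norm phi),
      (forall phi, U_GF (U_FG phi) = phi) /\
      (forall phi, U_FG (U_GF phi) = phi)
    & forall (psi : L2 muG) (phi : L2 muF),
        L2inner psi (U_FG phi) = L2inner (U_GF psi) phi].
Proof.
move=> T_FG T_GF U_FG U_GF.
have mpFG : measure_preserving muG muF T_FG.
  exact: (fractal_transformation_measure_preserving F_nonoverlapping
    G_nonoverlapping p_probability).
have mpGF : measure_preserving muF muG T_GF.
  exact: (fractal_transformation_measure_preserving G_nonoverlapping
    F_nonoverlapping p_probability).
have FGK : {ae muF, forall x, T_GF (T_FG x) = x}.
  exact: (fractal_transformationK F_nonoverlapping G_nonoverlapping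
    p_probability muF_invariant muG_invariant).
have GFK : {ae muG, forall y, T_FG (T_GF y) = y}.
  exact: (fractal_transformationK G_nonoverlapping F_nonoverlapping
    p_probability muG_invariant muF_invariant).
split.
- by split; exact: comp_operator_well_defined.
- split; (split; [exact: comp_operator_linear|exact: comp_operator_norm]).
- by split; exact: comp_operatorK.
- exact: L2inner_comp_operator.
Qed.
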